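(* Let $\widehat G$ be a minimum interval supergraph of a graph $G$ and let $M$ be a connected module of $\widehat G$ such that $\widehat G[M]$ is not a clique. Then for any minimum interval supergraph $\widehat G_M$ of $G[M]$, the graph $\widehat G'$ obtained from $\widehat G$ by replacing the edges of $\widehat G[M]$ by the edges of $\widehat G_M$ (keeping all edges with at most one end in $M$) is a minimum interval supergraph of $G$. In particular, $\widehat G[M]$ is a minimum interval supergraph of $G[M]$.
   Context: Graphs are finite, simple, undirected. A set $M$ is a module of a graph $H$ if every vertex outside $M$ is adjacent to all or none of $M$; a connected module if moreover $H[M]$ is connected. An interval supergraph of $G$ is an interval graph on $V(G)$ containing all edges of $G$; it is minimum if it has the minimum number of edges among all interval supergraphs of $G$. *)

(* Defs.v *)
From mathcomp Require Import all_boot all_order all_algebra.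
From mathcomp Require Import reals.

Set Implicit Arguments.
Unset Strict Implicit.
Unset Printing Implicit Defensive.

Import Order.TTheory GRing.Theory Num.Theory.

Record sgraph (T : finType) := SGraph {
  adj :> rel T;
  adj_sym : symmetric adj;
  adj_irr : irreflexive adj
}.

Section Graphs.
Variable T : finType.
Implicit Types (G H : sgraph T) (M : {set T}).

Definition edges G : {set {set T}} :=
  [set [set x; y] | x in T, y in T & G x y].

Definition subgraph G H := forall x y, G x y -> H x y.

Definition is_clique G := forall x y, x != y -> G x y.

Definition is_connected G := forall x y, connect G x y.

Definition is_module H M :=
  forall x, x \notin M ->
    (forall y, y \in M -> H x y) \/ (forall y, y \in M -> ~~ H x y).

End Graphs.

Section Modules.
Variable T : finType.
Implicit Types (G H : sgraph T) (M : {set T}).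

Lemma induced_sym G M :
  symmetric (fun x y : {x : T | x \in M} => G (val x) (val y)).
Proof. by move=> x y; rewrite adj_sym. Qed.

Lemma induced_irr G M :
  irreflexive (fun x y : {x : T | x \in M} => G (val x) (val y)).
Proof. by move=> x; rewrite adj_irr. Qed.

Definition induced G M : sgraph {x : T | x \in M} :=
  SGraph (@induced_sym G M) (@induced_irr G M).

Definition connected_module H M := is_module H M /\ is_connected (induced H M).

Definition replace_rel H M (K : sgraph {x : T | x \in M}) : rel T :=
  fun x y =>
    match insub x, insub y with
    | Some x', Some y' => K x' y'
    | _, _ => H x y
    end.

Lemma replace_sym H M K : symmetric (@replace_rel H M K).
Proof.
move=> x y; rewrite /replace_rel.
by case: (insub x) => [x'|]; case: (insub y) => [y'|]; rewrite adj_sym.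
Qed.

Lemma replace_irr H M K : irreflexive (@replace_rel H M K).
Proof.
by move=> x; rewrite /replace_rel; case: (insub x) => [x'|]; rewrite adj_irr.
Qed.

Definition replace_edges H M K : sgraph T :=
  SGraph (@replace_sym H M K) (@replace_irr H M K).

End Modules.

Local Open Scope ring_scope.

Section IntervalGraphs.
Variables (R : realType) (T : finType).
Implicit Types G H : sgraph T.

(* Intersection graph of nonempty closed intervals [l x, r x] of the real line. *)
Definition interval_graph G :=
  exists l r : T -> R,
    (forall x, l x <= r x) /\
    (forall x y, x != y ->
       (G x y <-> exists t, t \in `[l x, r x] /\ t \in `[l y, r y])).

Definition interval_supergraph G H := interval_graph H /\ subgraph G H.

Definition min_interval_supergraph G H :=
  interval_supergraph G H /\
  forall H', interval_supergraph G H' -> (#|edges H| <= #|edges H'|)%N.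

End IntervalGraphs.

(* Main.v *)
(** In an interval representation of [Gh], pick non-adjacent [a], [b] in [M], with
    [a] to the left of [b]. The gap [[r a, l b]] lies inside the interval of every
    outside neighbour of [M], and, [M] being connected, it misses the interval of
    every outside non-neighbour. Any interval representation of a graph on [M] can
    therefore be squeezed into that gap, so substituting an arbitrary interval graph
    for [Gh[M]] preserves being an interval graph; both claims then follow by
    counting the edges inside and outside [M]. *)

Require Import Defs.
From mathcomp Require Import all_boot all_order all_algebra.
From mathcomp Require Import reals lra.

Set Implicit Arguments.
Unset Strict Implicit.
Unset Printing Implicit Defensive.

Import Order.TTheory GRing.Theory Num.Theory.

Section Edges.
Variable T : finType.
Implicit Types (G H : sgraph T) (E : {set T}).

Lemma edgesP G E :
  reflect (exists x y, E = [set x; y] /\ G x y) (E \in edges G).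
Proof.
apply: (iffP imset2P) => [[x y _ /[!inE] Gxy ->]|[x [y [-> Gxy]]]].
  by exists x, y.
by exists x y; rewrite ?inE.
Qed.

Lemma eq_edges G H : G =2 H -> edges G = edges H.
Proof.
move=> eqGH; apply/setP => E.
by apply/edgesP/edgesP => -[x [y [-> Gxy]]]; exists x, y; rewrite ?eqGH // -eqGH.
Qed.

End Edges.

Section EdgeCounting.
Variable T : finType.
Implicit Types (G : sgraph T) (M : {set T}).

Lemma edges_inside G M :
  edges G :&: powerset M = [set val @: E | E : {set {x | x \in M}} in edges (induced G M)].
Proof.
apply/setP => E; rewrite in_setI powersetE; apply/andP/imsetP.
  case=> /edgesP [x [y [-> Gxy]]]; rewrite subUset !sub1set => /andP [xM yM].
  exists [set Sub x xM; Sub y yM]; last by rewrite imsetU1 imset_set1.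
  by apply/edgesP; exists (Sub x xM), (Sub y yM).
case=> _ /edgesP [x [y [-> Gxy]]] ->; rewrite imsetU1 imset_set1; split.
  by apply/edgesP; exists (val x), (val y).
by rewrite subUset !sub1set (valP x) (valP y).
Qed.

(** The second summand counts the edges with an end outside [M], which replacement inside [M] leaves
    alone. *)
Lemma card_edges_split G M :
  #|edges G| = (#|edges (induced G M)| + #|edges G :\: powerset M|)%N.
Proof.
rewrite -(cardsID (powerset M) (edges G)) edges_inside card_imset //.
exact/imset_inj/val_inj.
Qed.

End EdgeCounting.

Section Replace.
Variables (T : finType) (H : sgraph T) (M : {set T}).
Variable K : sgraph {x : T | x \in M}.

Lemma replace_in x y : replace_edges H K (val x) (val y) = K x y.
Proof. by rewrite /= /replace_rel !valK. Qed.

Lemma replace_outl x y : x \notin M -> replace_edges H K x y = H x y.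
Proof. by move=> xM; rewrite /= /replace_rel insubN. Qed.

Lemma replace_outr x y : y \notin M -> replace_edges H K x y = H x y.
Proof. by move=> yM; rewrite adj_sym replace_outl // adj_sym. Qed.

Lemma card_edges_replace :
  #|edges (replace_edges H K)| = (#|edges K| + #|edges H :\: powerset M|)%N.
Proof.
rewrite (card_edges_split _ M); congr (_ + _)%N.
  by congr #|pred_of_set _|; apply: eq_edges => x y; rewrite -replace_in.
congr #|pred_of_set _|; apply/setP => E; rewrite !in_setD !powersetE.
case: (boolP (E \subset M)) => //= EM.
(* A pair not contained in [M] has an end outside [M], where both graphs agree. *)
have outE x y : E = [set x; y] -> replace_edges H K x y = H x y.
  move=> defE; move: EM; rewrite defE subUset !sub1set negb_and.
  by case/orP => [/replace_outl|/replace_outr].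
by apply/edgesP/edgesP => -[x [y [defE xy]]]; exists x, y;
  rewrite (outE _ _ defE) in xy *.
Qed.

Lemma replace_subgraph G :
  subgraph G H -> subgraph (induced G M) K -> subgraph G (replace_edges H K).
Proof.
move=> GH GK x y Gxy.
case: (boolP (x \in M)) => [xM|/replace_outl->]; last exact: GH.
case: (boolP (y \in M)) => [yM|/replace_outr->]; last exact: GH.
by rewrite (replace_in (Sub x xM) (Sub y yM)); apply: GK.
Qed.

End Replace.

Local Open Scope ring_scope.

Section IntervalRepresentations.
Variables (R : realType) (T : finType).
Implicit Types (G : sgraph T) (l r : T -> R).

(** Two closed intervals meet iff each starts no later than the other ends, so adjacency becomes a
    boolean test on endpoints. *)
Definition interval_rep G l r :=
  (forall x, l x <= r x) /\
  (forall x y, x != y -> G x y = (l x <= r y) && (l y <= r x)).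

Lemma itv_meetP (a b c d : R) : a <= b -> c <= d ->
  reflect (exists t, t \in `[a, b] /\ t \in `[c, d]) ((a <= d) && (c <= b)).
Proof.
move=> ab cd; apply: (iffP andP) => [[ad cb]|[t []]].
  by exists (Num.max a c); rewrite !in_itv /= !le_max !ge_max !lexx ab ad cb cd orbT.
rewrite !in_itv /= => /andP [at_ tb] /andP [ct td].
by split; [exact: le_trans at_ td|exact: le_trans ct tb].
Qed.

Lemma interval_graphP G :
  interval_graph R G <-> exists l r, interval_rep G l r.
Proof.
split=> -[l [r [lr rep]]]; exists l, r; split=> // x y xy.
  by apply/idP/itv_meetP => //; apply rep.
by rewrite rep //; split=> /(itv_meetP (lr x) (lr y)).
Qed.

(** The finitely many endpoints are bounded, and an increasing affine map preserves every comparison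
    between them. *)
Lemma interval_rep_within G (c d : R) : interval_graph R G -> c < d ->
  exists l r, interval_rep G l r /\ forall x, c <= l x /\ r x <= d.
Proof.
move=> /interval_graphP [l [r [lr rep]]] cd.
(* All endpoints lie in [[-B, B]]; the summand 1 keeps [B] positive even when the sum vanishes. *)
pose B : R := 1 + \sum_x (`|l x| + `|r x|).
have sum_ge x : `|l x| + `|r x| <= \sum_x (`|l x| + `|r x|).
  by rewrite (bigD1 x) //= lerDl sumr_ge0 // => i _; rewrite addr_ge0.
have B_gt0 : 0 < B.
  by rewrite ltr_pwDl // sumr_ge0 // => i _; rewrite addr_ge0.
pose k := (d - c) / (2 * B).
have k_gt0 : 0 < k by rewrite divr_gt0 ?mulr_gt0 ?subr_gt0.
have kB : k * (2 * B) = d - c by rewrite divfK // lt0r_neq0 // mulr_gt0.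
(* [f] sends [-B] to [c] and [B] to [d]. *)
pose f t := c + k * (t + B).
have fle s t : (f s <= f t) = (s <= t) by rewrite lerD2l ler_pM2l // lerD2r.
exists (f \o l), (f \o r); split; first by split=> [x|x y xy] /=; rewrite ?rep // !fle.
move=> x; have := sum_ge x; have := ler_norm (- l x); have := ler_norm (r x).
have := normr_ge0 (l x); have := normr_ge0 (r x); rewrite normrN => *; split.
  by rewrite /= /f lerDl mulr_ge0 ?(ltW k_gt0) // /B; lra.
rewrite /= /f -lerBrDl -kB ler_pM2l // /B; lra.
Qed.

End IntervalRepresentations.

Section IntervalModules.
Variables (R : realType) (T : finType).
Implicit Types (H : sgraph T) (M : {set T}) (l r : T -> R).

Lemma induced_interval H M : interval_graph R H -> interval_graph R (induced H M).
Proof.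
case=> l [r [lr rep]]; exists (l \o val), (r \o val).
by split=> [x|x y xy] /=; [exact: lr|apply: rep].
Qed.

(* A non-neighbour inside the gap would separate the connected set [M]. *)
Lemma nonneighbor_misses_gap H M l r x (a b : {x : T | x \in M}) :
  interval_rep H l r -> is_connected (induced H M) ->
  x \notin M -> (forall y, y \in M -> ~~ H x y) -> r (val a) < l (val b) ->
  ~~ ((r (val a) <= r x) && (l x <= l (val b))).
Proof.
move=> [lr rep] conn xM nHx ab; apply/negP => /andP [arx lxb].
have side (y : {x : T | x \in M}) : (r (val y) < l x) || (r x < l (val y)).
  have := nHx _ (valP y); rewrite rep; last first.
    by apply: contraNneq xM => ->; apply: valP.
  by rewrite negb_and -!ltNge orbC.
(* Vertices of [M] on opposite sides of the interval of [x] have disjoint intervals, so no edge of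
   [H[M]] crosses it. Yet [a] lies to its left and [b] to its right. *)
have closed_left : closed (induced H M) [pred y | r (val y) < l x].
  apply: intro_closed; first by apply: sym_connect_sym; exact: adj_sym.
  move=> y z /= yz; rewrite !inE => yx.
  case/orP: (side z) => // xz; move: yz; rewrite rep.
    by case/andP => _ zy; have := lr x; lra.
  by apply: contraTneq xz => /val_inj <-; have := lr x; have := lr (val y); rewrite -leNgt; lra.
have aleft : r (val a) < l x.
  by case/orP: (side a) => //; have := lr (val a); lra.
have := closed_connect closed_left (conn a b); rewrite !inE aleft.
by move=> /esym bleft; have := lr (val b); lra.
Qed.

(** Otherwise every left endpoint in [M] is at most every right endpoint, so all these intervals
    meet pairwise. *)
Lemma nonclique_gap H M l r : interval_rep H l r -> ~ is_clique (induced H M) ->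
  exists a b : {x : T | x \in M}, r (val a) < l (val b).
Proof.
move=> [lr rep] ncl.
case: (boolP [exists a : {x : T | x \in M}, exists b : {x : T | x \in M},
                r (val a) < l (val b)]).
  by case/existsP => a /existsP [b ab]; exists a, b.
move=> nex; case: ncl => x y xy /=.
have nlt (u v : {x : T | x \in M}) : l (val u) <= r (val v).
  rewrite leNgt; apply: contra nex => vu.
  by apply/existsP; exists v; apply/existsP; exists u.
by rewrite rep ?(inj_eq val_inj) // !nlt.
Qed.

Lemma replace_interval H M (K : sgraph {x : T | x \in M}) :
  interval_graph R H -> connected_module H M -> ~ is_clique (induced H M) ->
  interval_graph R K -> interval_graph R (replace_edges H K).
Proof.
move=> /interval_graphP [l [r Hrep]] [modM conn] ncl Kint.
have [a [b ab]] := nonclique_gap Hrep ncl.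
have [lK [rK [[lrK repK] inK]]] := interval_rep_within Kint ab.
have [lr rep] := Hrep.
(* Outside [M] the old intervals stay; inside, those of [K] are used, rescaled into the gap. *)
pose l' x := if insub x is Some x' then lK x' else l x.
pose r' x := if insub x is Some x' then rK x' else r x.
have lin x : l' (val x) = lK x by rewrite /l' valK.
have rin x : r' (val x) = rK x by rewrite /r' valK.
have lout x : x \notin M -> l' x = l x by move=> xM; rewrite /l' insubN.
have rout x : x \notin M -> r' x = r x by move=> xM; rewrite /r' insubN.
have cross x (y : {x : T | x \in M}) : x \notin M ->
    H x (val y) = (l x <= rK y) && (lK y <= r x).
  move=> xM; have [cl rd] := inK y; have lry := lrK y.
  have neq (z : {x : T | x \in M}) : x != val z.
    by apply: contraNneq xM => ->; apply: valP.
  case: (modM x xM) => adjx.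
    (* Meeting the intervals of both [a] and [b], the interval of [x] covers the gap and hence meets
       every interval placed in it. *)
    have := adjx _ (valP a); rewrite rep // => /andP [xa _].
    have := adjx _ (valP b); rewrite rep // => /andP [_ bx].
    by rewrite adjx ?(valP y) //; apply/esym/andP; split; lra.
  rewrite (negbTE (adjx _ (valP y))); apply/esym/negP => /andP [xy yx].
  (* Meeting an interval placed in the gap would mean meeting the gap itself. *)
  have /negP[] := nonneighbor_misses_gap Hrep conn xM adjx ab.
  by apply/andP; split; lra.
apply/interval_graphP; exists l', r'; split=> [x|x y xy].
  by rewrite /l' /r'; case: insub.
case: (boolP (x \in M)) => xM; case: (boolP (y \in M)) => yM.
- rewrite -[x]/(val (Sub x xM : {x | x \in M})) -[y]/(val (Sub y yM : {x | x \in M})).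
  by rewrite replace_in !lin !rin repK.
- rewrite -[x]/(val (Sub x xM : {x | x \in M})) replace_outr // lin rin lout // rout //.
  by rewrite adj_sym cross // andbC.
- rewrite -[y]/(val (Sub y yM : {x | x \in M})) replace_outl // lin rin lout // rout //.
  by rewrite cross.
- by rewrite replace_outl // !lout // !rout // rep.
Qed.

End IntervalModules.

Theorem theorem4 (R : realType) (T : finType) (G Gh : sgraph T) (M : {set T})
  (hmin : min_interval_supergraph R G Gh)
  (hmod : connected_module Gh M)
  (hncl : ~ is_clique (induced Gh M)) :
  (forall GM : sgraph {x : T | x \in M},
     min_interval_supergraph R (induced G M) GM ->
     min_interval_supergraph R G (replace_edges Gh GM)) /\
  min_interval_supergraph R (induced G M) (induced Gh M).
Proof.
have [[Ghint GGh] minGh] := hmin.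
have superM : interval_supergraph R (induced G M) (induced Gh M).
  by split; [exact: induced_interval|move=> x y; apply: GGh].
have superR K : interval_supergraph R (induced G M) K ->
    interval_supergraph R G (replace_edges Gh K).
  by case=> Kint GK; split; [exact: replace_interval|exact: replace_subgraph].
split=> [GM [GMsuper minGM]|].
  split; first exact: superR.
  (* It suffices to compare with [Gh]: the outside edges cancel, and [GM] has at most as many edges
     as its competitor [Gh[M]]. *)
  move=> H' /minGh; apply: leq_trans.
  by rewrite card_edges_replace (card_edges_split Gh M) leq_add2r minGM.
(* A competitor [K] of [Gh[M]] extends to a competitor of [Gh] with the same outside edges, which
   again cancel. *)
split=> // K /superR /minGh.
by rewrite card_edges_replace (card_edges_split Gh M) leq_add2r.
Qed.
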